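(* Let $k$ and $l$ be integers with $k,l\ge 2$ of opposite parity, with $k\ge 2l+1$ if $k$ is odd and $k\ge 2l-2$ if $k$ is even, and let $d=\frac{1}{2}(3k+l+1)$. Then: (i) $S(d,k,k+l)=4k+2l$; and (ii) for $l=2$ or $l=3$ there is a unique (up to isomorphism) symmetric circuit code in $\mathcal{F}(d,k,k+l)$ of length $S(d,k,k+l)$.
   Context: Let $I(d)$ be the graph of the $d$-dimensional hypercube, with vertex set $\{0,1\}^d$, two vertices being adjacent iff they differ in exactly one position; write $[d]=\{1,\ldots,d\}$. For a positive integer $k$, a $(d,k)$ circuit code ($d$-dimensional circuit code of spread $k$) is a cycle $C$ in $I(d)$ such that $d_{I(d)}(x,y)\ge \min\{d_C(x,y),k\}$ for all vertices $x,y$ of $C$, where $d_{I(d)}$ is the graph distance in $I(d)$ (Hamming distance) and $d_C$ is the graph distance along the cycle $C$. The length $|C|$ is the number $N$ of vertices of $C$. By convention every circuit code $C=(x_1,\ldots,x_N)$ begins at $x_1=\vec 0$, and $C$ is equivalent to its transition sequence $T(C)=(\tau_1,\ldots,\tau_N)$, where $\tau_i\in[d]$ is the single position in which $x_i$ and $x_{i+1}$ differ (with $x_{N+1}=x_1$). The values $\tau_i$ are called transition elements. A segment of $T(C)$ is a cyclically consecutive subsequence $(\tau_i,\tau_{i+1},\ldots,\tau_j)$ (subscripts greater than $N$ reduced modulo $N$). A segment is a bit run if no transition element appears in it more than once. $\varphi(C)$ denotes the maximum length of a bit run in $T(C)$. $C$ is symmetric if $\tau_i=\tau_{i+N/2}$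 for $i=1,\ldots,N/2$. $\mathcal{F}(d,k,r)$ is the family of $(d,k)$ circuit codes $C$ with $\varphi(C)\ge r$, and $S(d,k,r)=\max\{|C| : C\in\mathcal{F}(d,k,r)\text{ and } C\text{ is symmetric}\}$. Circuit codes $C$ and $C'$ of $I(d)$ are isomorphic if $T(C)$ can be transformed into $T(C')$ by applying only a cyclic shift of the transitions and an automorphism (i.e. permutation) of $[d]$ applied to the transition elements. *)

(* Defs.v *)
#[warnings="-notation-overridden"] From mathcomp Require Import all_boot all_fingroup.

Set Implicit Arguments.
Unset Strict Implicit.
Unset Printing Implicit Defensive.

Definition cube (d : nat) := {ffun 'I_d -> bool}.

Definition cube0 (d : nat) : cube d := [ffun=> false].

Definition hamming (d : nat) (x y : cube d) : nat := #|[set i | x i != y i]|.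

Definition cube_adj (d : nat) : rel (cube d) := fun x y => hamming x y == 1.

(* [arc C x y] starts at x and stops just before y, so its size is the number
   of edges from x to y in the direction of traversal (0 when x = y). *)
Definition cycle_dist (d : nat) (C : seq (cube d)) (x y : cube d) : nat :=
  minn (size (arc C x y)) (size (arc C y x)).

(* The condition 2 < size C excludes the degenerate closed walks on at most two
   vertices that [ucycleb] accepts but that are not cycles of a simple graph. *)
Definition circuit_code (d k : nat) (C : seq (cube d)) : bool :=
  [&& 2 < size C, ucycleb (@cube_adj d) C, ohead C == Some (cube0 d)
    & all2rel (fun x y => minn (cycle_dist C x y) k <= hamming x y) C].

(* On a cycle of the cube, [next C x] differs from x in exactly one position, so
   [pick] returns that position and [pmap] drops nothing. *)
Definition transitions (d : nat) (C : seq (cube d)) : seq 'I_d :=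
  pmap (fun x : cube d => [pick i | x i != next C x i]) C.

(* The cyclic segment of length n <= size T starting at (0-based) position i. *)
Definition segment (A : Type) (T : seq A) (i n : nat) : seq A :=
  take n (rot i T).

Definition max_bit_run (d : nat) (C : seq (cube d)) : nat :=
  \max_(i < size C)
    \max_(n < (size C).+1 | uniq (segment (transitions C) i n)) n.

Definition symmetric_code (d : nat) (C : seq (cube d)) : bool :=
  take (size C)./2 (transitions C) == drop (size C)./2 (transitions C).

Definition code_family (d k r : nat) (C : seq (cube d)) : bool :=
  circuit_code k C && (r <= max_bit_run C).

(* Vertices of a cycle are distinct, so lengths are bounded by #|cube d|; the
   maximum over an empty family is 0 by convention. *)
Definition max_sym_length (d k r : nat) : nat :=
  \max_(N < #|cube d|.+1
        | [exists C : N.-tuple (cube d),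
             code_family k r C && symmetric_code C]) N.

(* Reversing the direction of traversal is not an allowed isomorphism. *)
Definition code_iso (d : nat) (C C' : seq (cube d)) : Prop :=
  exists (i : nat) (s : {perm 'I_d}),
    [seq s t | t <- rot i (transitions C)] = transitions C'.

(* Main.v *)
Require Import Defs.
From mathcomp Require Import all_boot all_fingroup zify.

Set Implicit Arguments.
Unset Strict Implicit.
Unset Printing Implicit Defensive.

(** Following m consecutive transitions moves a vertex to Hamming distance the
    number of letters that occur an odd number of times among them. A symmetric
    code of length 2n and spread k is thus the same thing as an n-periodic word
    tau in which every window of length m <= n has at least min(m, k) odd
    letters ([code_walk], [symmetric_word], [code_of_word]). In particular any
    k + 1 consecutive letters of tau are distinct ([spread_gap]).

    Upper bound. Rotate tau so that it reads D r D r and so on, where D is a bit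
    run of length K = k + l. Exactly (k - l + 1) / 2 letters lie outside D. Let R
    be the set of odd letters of a prefix of r of length t >= k. That prefix, and
    the same prefix preceded by D, both have at least k odd letters; with so few
    letters outside D this forces R to contain all of them and #|R| to be k or
    k + 1, whichever has the parity of t ([run_tail]). Suppose r is longer than k.
    If its length has not the parity of k, a full period has only k odd letters,
    and deleting one of them leaves a window with k - 1. Otherwise the letter
    number k + 1 of r repeats the letter number 0, hence is one of the first l
    letters of D, and r is not longer than k + l; but then that letter comes back
    within 2l - 2 <= k places, in the next copy of D. So n <= 2k + l
    ([period_le_of_run]).

    Equality. Now r has length k, its letters are distinct, and a full period has
    k + 1 odd letters, no two of them at consecutive places, since deleting both
    would leave a window with k - 1 ([odd_period_sparse]). Counting, the letters
    of D at odd places (from 0) are those that recur in r. As equal letters are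
    more than k apart, tau y recurs at a place i of r with i < y < i + l
    ([tail_letter_pos]). Conversely, these properties suffice: a window whose
    complement in a period has distinct letters is controlled by sparsity, and a
    window across one border between D and r has at most as many repeated letters as
    there are odd places in a certain interval ([normal_spread]). The word of
    [normal_word] has these properties, which gives a code of length 4k + 2l.

    Uniqueness. For l = 2 the only choice is i = y - 1. For l = 3 it is y - 1 or
    y - 2, and sparsity makes the second choice persist once it has been made;
    starting the word at a suitable later place makes the switch occur at the very
    beginning ([normal_shift_l3]). Either way some rotation is normal, and two
    normal words differ by a permutation of the letters ([relabel_normal]). *)

(** * Windows of sequences, and odd letters *)

Definition window (A : Type) (f : nat -> A) (i n : nat) : seq A :=
  map f (iota i n).

Definition periodic (A : Type) (n : nat) (f : nat -> A) : Prop :=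
  forall j, f (j + n) = f j.

Section Windows.
Variables (A : Type) (f : nat -> A).

Lemma size_window i n : size (window f i n) = n.
Proof. by rewrite size_map size_iota. Qed.

Lemma window_cat i m n : window f i (m + n) = window f i m ++ window f (i + m) n.
Proof. by rewrite /window iotaD map_cat. Qed.

Lemma window_split i m n : m <= n ->
  window f i n = window f i m ++ window f (i + m) (n - m).
Proof. by move=> le_mn; rewrite -window_cat subnKC. Qed.

Lemma window1 i : window f i 1 = [:: f i]. Proof. by []. Qed.

Lemma nth_window x0 i n j : j < n -> nth x0 (window f i n) j = f (i + j).
Proof. by move=> lt_jn; rewrite (nth_map 0) ?size_iota // nth_iota. Qed.

Lemma take_window i m n : m <= n -> take m (window f i n) = window f i m.
Proof. by move=> le_mn; rewrite -map_take take_iota (minn_idPl le_mn). Qed.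

Lemma drop_window i m n : drop m (window f i n) = window f (i + m) (n - m).
Proof. by rewrite -map_drop drop_iota. Qed.

Lemma window_add p i n : window (fun j => f (p + j)) i n = window f (p + i) n.
Proof. by rewrite /window iotaDl -map_comp. Qed.

Lemma window_shift n i m : periodic n f -> window f (i + n) m = window f i m.
Proof.
by move=> per; rewrite addnC -window_add; apply: eq_map => j; rewrite addnC.
Qed.

Lemma window_shift_mul n q i m : periodic n f ->
  window f (i + q * n) m = window f i m.
Proof.
move=> per; elim: q => [|q IH]; rewrite ?addn0 //.
by rewrite mulSn (addnC n) addnA window_shift.
Qed.

Lemma periodic_mul n q j : periodic n f -> f (j + q * n) = f j.
Proof.
by move=> per; elim: q => [|q IH]; rewrite ?addn0 // mulSn (addnC n) addnA per.
Qed.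

Lemma periodic_mod n j : periodic n f -> f (j %% n) = f j.
Proof. by move=> per; rewrite {2}(divn_eq j n) addnC periodic_mul. Qed.

Lemma rot_window n p i : periodic n f -> p <= n ->
  rot p (window f i n) = window f (i + p) n.
Proof.
move=> per le_pn; rewrite /rot drop_window take_window //.
rewrite -(window_shift i p per) (window_split (i + p) (leq_subr p n)) subKn //.
by congr (_ ++ window _ _ _); lia.
Qed.

End Windows.

Section WindowLetters.
Variables (A : eqType) (f : nat -> A).

Lemma mem_windowP i n x :
  reflect (exists2 j, i <= j < i + n & x = f j) (x \in window f i n).
Proof.
apply: (iffP mapP) => [[j] | [j] hj ->]; first by rewrite mem_iota; exists j.
by exists j; rewrite // mem_iota.
Qed.

Lemma mem_window i n j : i <= j < i + n -> f j \in window f i n.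
Proof. by move=> hj; apply/mem_windowP; exists j. Qed.

Lemma window_uniqP i n :
  reflect (forall a b, i <= a -> a < b -> b < i + n -> f a <> f b)
          (uniq (window f i n)).
Proof.
apply: (iffP idP) => [Uw a b ia ab bn fab | inj].
  have ha : a - i < n by lia.
  have hb : b - i < n by lia.
  have := nth_uniq (f 0) _ _ Uw; rewrite size_window => /(_ _ _ ha hb).
  rewrite !nth_window // !subnKC //; last by lia.
  rewrite fab eqxx => /esym/eqP h. lia.
rewrite map_inj_in_uniq ?iota_uniq // => a b.
rewrite !mem_iota => ha hb fab.
case: (ltngtP a b) => // h; first by case: (inj a b) => //; lia.
by case: (inj b a) => //; lia.
Qed.

Lemma window_uniq_inj i n a b : uniq (window f i n) ->
  i <= a < i + n -> i <= b < i + n -> f a = f b -> a = b.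
Proof.
move=> /window_uniqP Uw ha hb fab.
by case: (ltngtP a b) => // h; [case: (Uw a b) | case: (Uw b a)] => //; lia.
Qed.

Lemma sub_window_uniq i n j m : i <= j -> j + m <= i + n ->
  uniq (window f i n) -> uniq (window f j m).
Proof.
move=> ij jm /window_uniqP Uw; apply/window_uniqP => a b ja ab bm.
by apply: Uw; lia.
Qed.

End WindowLetters.

Section OddLetters.
Variable T : finType.
Implicit Types (s u v : seq T) (x : T) (tau : nat -> T).

Definition odd_letters s : {set T} := [set x | odd (count_mem x s)].

Lemma odd_letters_cat u v x :
  x \in odd_letters (u ++ v) = (x \in odd_letters u) (+) (x \in odd_letters v).
Proof. by rewrite !inE count_cat oddD. Qed.

Lemma perm_odd_letters u v : perm_eq u v -> odd_letters u = odd_letters v.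
Proof. by move/seq.permP=> uv; apply/setP=> x; rewrite !inE uv. Qed.

Lemma odd_letters_uniq s x : uniq s -> x \in odd_letters s = (x \in s).
Proof. by move=> Us; rewrite !inE count_uniq_mem //; case: (x \in s). Qed.

Lemma odd_letters_sub s x : x \in odd_letters s -> x \in s.
Proof. by rewrite inE -has_pred1 has_count; case: (count _ _). Qed.

(** The odd letters of a concatenation are the symmetric difference of those of
    the parts. *)
Lemma card_odd_letters_cat u v : uniq v ->
  #|odd_letters (u ++ v)| + 2 * count [in odd_letters u] v
  = #|odd_letters u| + size v.
Proof.
set A := odd_letters u; set B := [set x in v] => Uv.
have -> : odd_letters (u ++ v) = (A :\: B) :|: (B :\: A).
  apply/setP => x; rewrite odd_letters_cat (odd_letters_uniq x Uv) !inE.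
  by case: (x \in v); case: (odd _).
have -> : count [in A] v = #|A :&: B|.
  rewrite -size_filter -(card_uniqP (filter_uniq _ Uv)).
  by apply: eq_card => x; rewrite mem_filter !inE.
have -> : size v = #|B| by rewrite cardsE; apply/esym/card_uniqP.
have disj : (A :\: B) :&: (B :\: A) = set0.
  by apply/setP=> x; rewrite !inE; case: (x \in v); rewrite ?andbF.
have := cardsID B A; have := cardsID A B; rewrite (setIC B A).
by rewrite cardsU disj cards0; lia.
Qed.

Lemma card_odd_letters_uniq s : uniq s -> #|odd_letters s| = size s.
Proof.
move=> Us; rewrite -(card_uniqP Us); apply: eq_card => x.
exact: odd_letters_uniq.
Qed.

Lemma card_odd_letters_le s : #|odd_letters s| <= size s.
Proof.
apply: leq_trans (card_size s); apply: subset_leq_card.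
by apply/subsetP => x; apply: odd_letters_sub.
Qed.

Lemma odd_card_odd_letters s : odd #|odd_letters s| = odd (size s).
Proof.
elim/last_ind: s => [|s x IH]; first by rewrite card_odd_letters_uniq.
have := @card_odd_letters_cat s [:: x] isT.
rewrite cats1 size_rcons /= -IH; lia.
Qed.

Lemma perm_window_period n tau p : periodic n tau ->
  perm_eq (window tau p n) (window tau 0 n).
Proof.
move=> per; elim: p => [|p IH] //; apply: perm_trans IH.
case: n per => [|n] per //; rewrite -addn1 -(rot_window _ per) //.
by rewrite perm_rot.
Qed.

Lemma odd_letters_period n tau p : periodic n tau ->
  odd_letters (window tau p n) = odd_letters (window tau 0 n).
Proof. by move=> per; apply/perm_odd_letters/perm_window_period. Qed.

(** Over a full period the odd letters do not depend on the starting point, so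
    the odd letters of a window are determined by the complementary window. *)
Lemma card_odd_letters_compl n tau p q : periodic n tau -> q <= n ->
  uniq (window tau p q) ->
  #|odd_letters (window tau (p + q) (n - q))|
    + 2 * count [in odd_letters (window tau 0 n)] (window tau p q)
  = #|odd_letters (window tau 0 n)| + q.
Proof.
move=> per le_qn Uw; set A := window tau p q; set B := window tau _ _.
have <- : odd_letters (A ++ B) = odd_letters (window tau 0 n).
  by rewrite -window_split // odd_letters_period.
rewrite -[X in _ = _ + X](size_window tau p q) -(card_odd_letters_cat _ Uw).
congr (_ + _); apply: eq_card => x; rewrite !odd_letters_cat.
by rewrite -/A addbC addKb.
Qed.

(** The windows longer than half the code are complements of shorter ones, so
    [m <= n] covers every pair of vertices of a symmetric code of length 2n. *)
Definition spread (k n : nat) tau : Prop :=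
  forall i m, m <= n -> minn m k <= #|odd_letters (window tau i m)|.

Lemma spread_ge k n tau i m : spread k n tau -> k <= m -> m <= n ->
  k <= #|odd_letters (window tau i m)|.
Proof. by move=> sp le_km le_mn; have := sp i m le_mn; rewrite (minn_idPr le_km). Qed.

(** Between two equal letters with at most k - 1 letters in between, the window that
    they delimit has length at most k + 1, and the pair cancels. *)
Lemma spread_gap k n tau a b : spread k n tau -> k < n ->
  tau a = tau b -> a < b -> k < b - a.
Proof.
move=> sp lt_kn eq_ab lt_ab; rewrite ltnNge; apply/negP => le_k.
have {sp} := sp a (b - a).+1.
have -> : (b - a).+1 = 1 + ((b - a).-1 + 1) by lia.
rewrite 2!window_cat !window1 (_ : a + 1 + (b - a).-1 = b); last by lia.
rewrite -eq_ab.
have -> : odd_letters ([:: tau a] ++ window tau (a + 1) (b - a).-1 ++ [:: tau a])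
          = odd_letters (window tau (a + 1) (b - a).-1).
  by apply/setP => x; rewrite !odd_letters_cat addbC -addbA addbb addbF.
have := card_odd_letters_le (window tau (a + 1) (b - a).-1).
rewrite size_window; lia.
Qed.

Lemma spread_uniq k n tau i m : spread k n tau -> k < n -> m <= k.+1 ->
  uniq (window tau i m).
Proof.
move=> sp lt_kn le_mk; apply/window_uniqP => a b ia ab bm eq_ab.
have := spread_gap sp lt_kn eq_ab ab; lia.
Qed.

End OddLetters.

(** * The length of a word with a long bit run *)

Section BitRun.
Variables (T : finType) (k l n : nat) (tau : nat -> T).
Hypotheses (l_gt1 : 1 < l) (le_l_k : 2 * l - 2 <= k) (odd_kl : odd k != odd l).
Hypothesis cardT : 2 * #|T| = 3 * k + l + 1.
Hypotheses (per : periodic n tau) (sp : spread k n tau) (le_n : k + l <= n).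
Hypothesis run : uniq (window tau 0 (k + l)).

Local Notation K := (k + l).
Local Notation D := (window tau 0 K).
Local Notation R t := (odd_letters (window tau K t)).

Let lt_kn : k < n. Proof. by lia. Qed.

Lemma run_compl_card : 2 * #|[set x | x \notin D]| = k.+1 - l.
Proof.
have := cardsC [set x in D]; rewrite cardsE (card_uniqP run) size_window.
have -> : ~: [set x in D] = [set x | x \notin D] by apply/setP => x; rewrite !inE.
by lia.
Qed.

(** With c letters of the run among the odd letters R of the prefix, the prefix
    alone gives #|R| >= k and the run followed by the prefix gives 2c <= #|R| + l.
    Hence #|R| - c is at least (k - l) / 2, and rounding up by parity this is the
    number of letters outside the run. *)
Lemma run_tail t : k <= t -> t <= n - K ->
  [/\ forall x, x \notin D -> x \in R t, k <= #|R t| <= k.+1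
    & 2 * count [in R t] D + k.+1 = 2 * #|R t| + l].
Proof.
move=> le_kt le_tn.
have le1 : k <= #|R t| by apply: spread_ge sp _ _; lia.
have le2 : k <= #|odd_letters (window tau K t ++ D)|.
  rewrite (perm_odd_letters (permEl (perm_catC _ _))) -window_cat.
  by apply: spread_ge sp _ _; lia.
have e1 := card_odd_letters_cat (window tau K t) run.
rewrite size_window in e1.
have e2 := cardsID [set x in D] (R t).
have e3 : #|R t :&: [set x in D]| = count [in R t] D.
  rewrite -size_filter -(card_uniqP (filter_uniq _ run)).
  by apply: eq_card => x; rewrite mem_filter !inE.
have e4 := run_compl_card.
have sub : R t :\: [set x in D] \subset [set x | x \notin D].
  by apply/subsetP => x; rewrite !inE => /andP[].
have e5 := subset_leq_card sub.
rewrite e3 in e2.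
have e6 : #|[set x | x \notin D]| <= #|R t :\: [set x in D]|.
  by move: e1 e2 e4 e5 le1 le2; lia.
have /setP eqE : R t :\: [set x in D] = [set x | x \notin D].
  by apply/eqP; rewrite eqEcard sub.
split; [| by move: e1 e2 e4 e5 le1 le2; lia | by move: e2 e4 e5 e6; lia].
by move=> x xD; have := eqE x; rewrite !inE xD => /andP[].
Qed.

(** A letter outside the run is already odd in the prefix, and must stay so. *)
Lemma run_tail_in_run t : k <= t -> t < n - K -> tau (K + t) \in D.
Proof.
move=> le_kt lt_tn; apply/idPn => xD.
have [/(_ _ xD) in1 _ _] := run_tail le_kt (ltnW lt_tn).
have [/(_ _ xD) in2 _ _] := run_tail (leqW le_kt) lt_tn.
move: in2; rewrite -[t.+1]addn1 window_cat odd_letters_cat in1.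
by rewrite odd_letters_uniq // window1 mem_seq1 eqxx.
Qed.

(** The letter number k + 1 of the tail makes the number of odd letters drop from
    k + 1 to k, so it repeats a tail letter; only the first one is more than k places
    away. *)
Lemma run_tail_return : k.+2 <= n - K -> tau (K + k.+1) = tau K.
Proof.
move=> lt_k2.
have [_ /andP[_ c2] _] := run_tail (leq_trans (leqnSn _) (leqnSn k.+1)) lt_k2.
have U1 : uniq (window tau K k.+1) by apply: spread_uniq sp _ _.
have e := @card_odd_letters_cat _ (window tau K k.+1) [:: tau (K + k.+1)] isT.
rewrite -window1 -window_cat addn1 (card_odd_letters_uniq U1) !size_window in e.
have : tau (K + k.+1) \in odd_letters (window tau K k.+1).
  apply/negPn/negP => hn; move: e; rewrite /= (negPf hn).
  by clear -c2; lia.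
rewrite odd_letters_uniq // => /mem_windowP[j hj ej].
have := spread_gap sp lt_kn (esym ej); rewrite ej.
by clear -hj => h; congr tau; lia.
Qed.

(** Otherwise the last l + 1 letters of the tail all cancel against the next copy of
    the run, leaving k - 1 odd letters. *)
Lemma run_tail_size : n - K <= k + l.
Proof.
rewrite leqNgt; apply/negP => lt_m.
have lt_ln : l.+1 <= n by clear -lt_m; lia.
have U1 : uniq (window tau (n - l.+1) l.+1).
  by apply: spread_uniq sp lt_kn _; clear -le_l_k l_gt1; lia.
have sD : window tau n K = D by rewrite -(window_shift 0 K per) add0n.
have ge : k <= #|odd_letters (D ++ window tau (n - l.+1) l.+1)|.
  rewrite -sD (perm_odd_letters (permEl (perm_catC _ _))) -{2}(subnK lt_ln).
  by rewrite -window_cat; apply: spread_ge sp _ _; clear -lt_m le_l_k l_gt1; lia.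
have e := card_odd_letters_cat D U1; move: e ge.
have -> : count [in odd_letters D] (window tau (n - l.+1) l.+1) = l.+1.
  rewrite -[RHS](size_window tau (n - l.+1)); apply/eqP; rewrite -all_count.
  apply/allP => _ /mem_windowP[j hj ->] /=; rewrite odd_letters_uniq //.
  have -> : j = K + (j - K) by clear -hj lt_m; lia.
  by apply: run_tail_in_run; clear -hj lt_m; lia.
by rewrite (card_odd_letters_uniq run) !size_window; clear; lia.
Qed.

Theorem period_le_of_run : n <= 2 * k + l.
Proof.
rewrite leqNgt; apply/negP => lt_n.
have le_km : k <= n - K by clear -lt_n; lia.
have [_ /andP[cge cle] cnt] := run_tail le_km (leqnn _).
have par := odd_card_odd_letters (window tau K (n - K)).
rewrite size_window in par.
have cardP : #|odd_letters (window tau 0 n)| + 2 * count [in R (n - K)] D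
             = #|R (n - K)| + K.
  have /perm_odd_letters-> : perm_eq (window tau 0 n) (window tau K (n - K) ++ D).
    by rewrite (window_split _ _ le_n) perm_catC.
  by rewrite (card_odd_letters_cat _ run) size_window.
have [par_m | par_m] := boolP (odd (n - K) == odd k); last first.
  (* The full period has k odd letters, and deleting a run letter that does not
     recur leaves k - 1 of them. *)
  have cR : #|R (n - K)| = k.+1.
    have ne_k : #|R (n - K)| <> k by move=> h; rewrite -par h eqxx in par_m.
    by clear -cge cle ne_k; lia.
  have /allPn[_ /mem_windowP[x /andP[_ hx] ->] xR] : ~~ all [in R (n - K)] D.
    by rewrite all_count size_window; clear -cnt cR l_gt1 le_l_k; lia.
  have xP : tau x \in odd_letters (window tau 0 n).
    rewrite (window_split _ _ le_n) odd_letters_cat (negPf xR) addbF.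
    by rewrite odd_letters_uniq // mem_window.
  have le_1n : 1 <= n by clear -lt_n; lia.
  have := card_odd_letters_compl per le_1n (isT : uniq (window tau x 1)).
  have : k <= #|odd_letters (window tau (x + 1) (n - 1))|.
    by apply: spread_ge sp _ _; clear -lt_n l_gt1; lia.
  by rewrite /= xP; clear -cardP cnt cR; lia.
have lt_k2 : k.+2 <= n - K.
  have ne_k1 : n - K <> k.+1 by move=> h; move: par_m; rewrite h /=; case: odd.
  by clear -lt_n ne_k1; lia.
have in_D : tau (K + k.+1) \in D.
  by apply: run_tail_in_run; clear -lt_k2; lia.
have [y /andP[_ hy] ey] := mem_windowP _ _ _ _ in_D.
have gap1 := spread_gap sp lt_kn (etrans (esym ey) (run_tail_return lt_k2)) hy.
(* The letter comes back at place y < l of the next copy of the run, at distance at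
   most 2l - 2. *)
have ey' : tau (K + k.+1) = tau (y + n) by rewrite per.
have := spread_gap sp lt_kn ey'; have := run_tail_size.
by clear -gap1 lt_k2 le_l_k hy; lia.
Qed.

End BitRun.

(** * Words that attain the bound *)

Lemma count_sparse (b : pred nat) i m : (forall p, ~~ (b p && b p.+1)) ->
  2 * count b (iota i m) <= m.+1.
Proof.
move=> sparse; have [q] := ubnP m; elim: q m i => // q IH [|[|m]] i lt_mq //.
  by rewrite /=; case: (b i).
have := IH m i.+2; have := sparse i; rewrite /=.
by case: (b i); case: (b i.+1) => //; lia.
Qed.

(** There is no slack: the prefix before place 2j and the suffix after it hold at
    most j and c - j of the c + 1 places. *)
Lemma sparse_alternates (b : pred nat) c i : (forall p, ~~ (b p && b p.+1)) ->
  count b (iota 0 (2 * c + 1)) = c.+1 -> i < 2 * c + 1 -> b i = ~~ odd i.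
Proof.
move=> sparse cb lt_i.
have even_in j : j <= c -> b (2 * j).
  move=> le_jc; have e : 2 * c + 1 = 2 * j + (2 * (c - j)).+1 by lia.
  have := @count_sparse b 0 (2 * j) sparse.
  have := @count_sparse b (2 * j).+1 (2 * (c - j)) sparse.
  move: cb; rewrite e iotaD count_cat add0n /=; case: (b (2 * j)) => //; lia.
have [odd_i | even_i] /= := boolP (odd i); last first.
  by rewrite -[i]odd_double_half (negPf even_i) -mul2n; apply: even_in; lia.
have := sparse i.-1; rewrite prednK; last by lia.
have -> : i.-1 = 2 * i./2 by lia.
by rewrite even_in; [move/negPf | lia].
Qed.

(** The run letters at odd places recur in the tail in increasing order: the first
    l - 1 of them in a block, then one after each letter from outside the run. *)
Definition normal_word (T : eqType) k l (tau : nat -> T) : Prop :=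
  forall i, i < k ->
    if i < l.-1 then tau (k + l + i) = tau (2 * i + 1)
    else if odd (i - l.-1) then tau (k + l + i) = tau (i + l.-1)
    else tau (k + l + i) \notin window tau 0 (k + l).

Section Extremal.
Variables (T : finType) (k l : nat) (tau : nat -> T).
Hypotheses (l_gt1 : 1 < l) (le_l_k : 2 * l - 2 <= k) (odd_kl : odd k != odd l).
Hypothesis cardT : 2 * #|T| = 3 * k + l + 1.
Local Notation K := (k + l).
Local Notation n := (2 * k + l).
Local Notation D := (window tau 0 K).
Local Notation P := (odd_letters (window tau 0 n)).
Hypotheses (per : periodic n tau) (sp : spread k n tau) (run : uniq D).

Let lt_kn : k < n. Proof. by lia. Qed.
Let le_Kn : K <= n. Proof. by lia. Qed.
Let n_sub_K : n - K = k. Proof. by lia. Qed.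

Lemma tail_uniq : uniq (window tau K k).
Proof. exact: spread_uniq sp _ _. Qed.

Lemma mem_odd_period x : (x \in P) = (x \in D) (+) (x \in window tau K k).
Proof.
rewrite (window_split _ _ le_Kn) n_sub_K odd_letters_cat.
by rewrite !odd_letters_uniq // tail_uniq.
Qed.

Lemma run_tail_count :
  2 * count [in odd_letters (window tau K k)] D + k.+1 = 2 * k + l.
Proof.
have le_k : k <= n - K by rewrite n_sub_K.
have [_ _] := run_tail l_gt1 le_l_k odd_kl cardT sp le_Kn run (leqnn k) le_k.
by rewrite (card_odd_letters_uniq tail_uniq) size_window.
Qed.

Lemma card_odd_period : #|P| = k.+1.
Proof.
have /perm_odd_letters-> : perm_eq (window tau 0 n) (window tau K k ++ D).
  by rewrite (window_split _ _ le_Kn) n_sub_K perm_catC.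
have := card_odd_letters_cat (window tau K k) run.
rewrite (card_odd_letters_uniq tail_uniq) !size_window.
have := run_tail_count; lia.
Qed.

(** Deleting two consecutive odd letters of the k + 1 would leave k - 1. *)
Lemma odd_period_sparse p : ~~ ((tau p \in P) && (tau p.+1 \in P)).
Proof.
apply/andP => -[p1 p2].
have U2 : uniq (window tau p 2) by apply: spread_uniq sp _ _; lia.
have le2 : 2 <= n by lia.
have := card_odd_letters_compl per le2 U2.
have : k <= #|odd_letters (window tau (p + 2) (n - 2))|.
  by apply: spread_ge sp _ _; lia.
by rewrite card_odd_period /= p1 p2; lia.
Qed.

(** A run letter is odd in the period when it does not recur in the tail. There are
    (K + 1) / 2 of these among K consecutive places, with K odd, and no two are
    adjacent. *)
Lemma run_letter_in_tail x : x < K -> (tau x \in window tau K k) = odd x.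
Proof.
move=> lt_xK; have xD : tau x \in D by rewrite mem_window.
have [c eK] : {c | K = 2 * c + 1} by exists K./2; lia.
have := @sparse_alternates (fun x => tau x \in P) c x odd_period_sparse.
rewrite -eK mem_odd_period xD => h; apply: negb_inj; rewrite -h //.
have := run_tail_count; have := count_predC [in P] D.
rewrite size_window -(count_map tau [in P]) -/(window tau 0 K).
have -> : count (predC [in P]) D = count [in odd_letters (window tau K k)] D.
  apply: eq_in_count => y yD /=.
  by rewrite mem_odd_period yD odd_letters_uniq ?tail_uniq //= negbK.
lia.
Qed.

(** The letter occurs before the tail at y and after it at y + n, both times more
    than k places away. *)
Lemma tail_letter_pos i y : i < k -> y < K -> tau (K + i) = tau y ->
  [/\ odd y, i < y & y < i + l].
Proof.
move=> lt_ik lt_yK e.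
have g1 := spread_gap sp lt_kn (esym e).
have e2 : tau (K + i) = tau (y + n) by rewrite per.
have g2 := spread_gap sp lt_kn e2.
split; [| lia | lia].
by rewrite -run_letter_in_tail // -e mem_window //; lia.
Qed.

Lemma tail_letter_in_run i : i < k -> tau (K + i) \in D ->
  exists y, [/\ tau (K + i) = tau y, odd y, i < y & y < i + l].
Proof.
move=> lt_ik /mem_windowP[y hy e]; exists y.
by have [] := tail_letter_pos lt_ik _ e; rewrite //; lia.
Qed.

Lemma odd_run_letter y : y < K -> odd y ->
  exists i, [/\ i < k, tau (K + i) = tau y, i < y & y < i + l].
Proof.
move=> lt_yK; rewrite -run_letter_in_tail // => /mem_windowP[j hj e].
exists (j - K); have ej : K + (j - K) = j by lia.
have lt_j : j - K < k by lia.
have [|_ y1 y2] := tail_letter_pos lt_j lt_yK; first by rewrite ej e.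
by split; rewrite // ej e.
Qed.

Lemma normal_word_l2 : l = 2 -> normal_word k l tau.
Proof.
move=> l2 i lt_ik; rewrite (_ : l.-1 = 1); last by rewrite l2.
have odd_case y : y < K -> odd y -> tau (K + y.-1) = tau y.
  move=> hy oy; have [j [hj e j1 j2]] := odd_run_letter hy oy.
  by rewrite -e; congr tau; lia.
case: ifP => [i0 | i0].
  have -> : i = 0 by lia.
  by apply: (odd_case 1); lia.
case: ifP => oi; first by rewrite addn1; apply: (odd_case i.+1); lia.
apply/negP => /(tail_letter_in_run lt_ik)[y [_ oy]]; lia.
Qed.

(** The letter at an odd place y of the run recurs at place y - 1 or y - 2 of the
    tail, and for 3 <= y < k the other of these two places holds a letter from
    outside the run. If it recurs at y - 2, the place y - 1 thus holds an odd letter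
    of the period; so place y does not, and must hold the letter of place y + 2. *)
Lemma normal_word_l3 : l = 3 -> tau (K + 1) = tau 3 -> normal_word k l tau.
Proof.
move=> l3 h1.
have start : tau K = tau 1.
  have [||i [hi e i1 i2]] := @odd_run_letter 1; [lia | by [] |].
  by rewrite -e; congr tau; lia.
have step i : odd i -> i.+1 < k -> tau (K + i) = tau i.+2 -> tau (K + i.+1) \notin D.
  move=> oi hi e; apply/negP => /(tail_letter_in_run hi)[y [ey oy y1 y2]].
  have yi : y = i.+2 by lia.
  have := window_uniq_inj tail_uniq (a := K + i) (b := K + i.+1).
  by rewrite e ey yi => /(_ _ _ erefl); lia.
have odd_case q : 2 * q + 1 < k -> tau (K + (2 * q + 1)) = tau (2 * q + 3).
  elim: q => [|q IH] hq; first exact: h1.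
  have {}IH := IH ltac:(lia).
  have nD : tau (K + (2 * q + 1).+1) \notin D.
    by apply: step; [lia | lia | rewrite IH; congr tau; lia].
  have inP : tau (K + (2 * q + 1).+1) \in P.
    by rewrite mem_odd_period (negPf nD) mem_window //; lia.
  have := odd_period_sparse (K + (2 * q + 1).+1); rewrite inP /=.
  have -> : (K + (2 * q + 1).+1).+1 = K + (2 * q.+1 + 1) by lia.
  rewrite mem_odd_period (mem_window tau (i := K)); last by lia.
  rewrite addbT negbK => /(tail_letter_in_run hq)[y [-> oy y1 y2]].
  by congr tau; lia.
move=> i lt_ik; rewrite (_ : l.-1 = 2); last by rewrite l3.
case: ifP => [i2 | i2].
  case: i i2 lt_ik => [|[|i]] // _ _; first by rewrite addn0.
case: ifP => oi.
  by have := odd_case i./2; rewrite (_ : 2 * i./2 + 1 = i);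
    [move=> ->; [congr tau | ] |]; lia.
rewrite -[i]prednK; last by lia.
apply: step; try lia.
have := odd_case i.-1./2; rewrite (_ : 2 * i.-1./2 + 1 = i.-1); last by lia.
by move=> ->; [congr tau | ]; lia.
Qed.

(** Let 2q + 1 be the first odd place of the tail that holds a run letter. The tail
    places before 2q only repeat letters from run places before 2q, so the window of
    length K from place 2q is again a bit run. *)
Lemma normal_shift_l3 : l = 3 ->
  exists p, [/\ p <= n, uniq (window tau p K) & tau (p + (K + 1)) = tau (p + 3)].
Proof.
move=> l3; pose good q := (2 * q + 1 < k) && (tau (K + (2 * q + 1)) \in D).
have exq : exists q, good q.
  have [||i [hi e i1 i2]] := @odd_run_letter k.+1; [lia | lia |].
  exists (k./2.-1); rewrite /good (_ : 2 * k./2.-1 + 1 = i); last by lia.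
  by rewrite hi e mem_window //; lia.
(* The last odd place of the tail is good, as it holds the letter k + 1. *)
case: (ex_minnP exq) => q /andP[lt_qk inD] qmin.
exists (2 * q); split; first by lia.
  apply/window_uniqP => u v hu uv hv e.
  have [lt_vK | le_Kv] := ltnP v K.
    by apply: (elimT (window_uniqP _ _ _) run u v) => //; lia.
  have [lt_uK | le_Ku] := ltnP u K; last first.
    by apply: (elimT (window_uniqP _ _ _) tail_uniq u v) => //; lia.
  have ev : K + (v - K) = v by lia.
  have hv' : v - K < k by lia.
  have [] := tail_letter_pos hv' lt_uK; first by rewrite ev.
  move=> ou u1 u2; have [ov | nov] := boolP (odd (v - K)); last by lia.
  have := qmin (v - K)./2; rewrite /good (_ : 2 * (v - K)./2 + 1 = v - K); last by lia.
  by rewrite ev hv' -e mem_window //; lia.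
have [y [e oy y1 y2]] := tail_letter_in_run lt_qk inD.
by rewrite (_ : 2 * q + (K + 1) = K + (2 * q + 1)) ?e; [congr tau | ]; lia.
Qed.
End Extremal.

(** * Normal words have the spread property *)

Lemma count_odd_bound (b : pred nat) i m i' m' :
  (forall x, i <= x < i + m -> b x -> odd x && (i' <= x < i' + m')) ->
  count b (iota i m) <= m'.+1./2.
Proof.
move=> sub; have odd_sparse p : ~~ (odd p && odd p.+1) by rewrite /=; case: odd.
have := @count_sparse odd i' m' odd_sparse.
suff : count b (iota i m) <= count odd (iota i' m') by lia.
rewrite -!size_filter uniq_leq_size ?filter_uniq ?iota_uniq // => x.
by rewrite !mem_filter !mem_iota => /andP[bx /sub/(_ bx)].
Qed.

Lemma count_odd_iota c : count odd (iota 0 (2 * c + 1)) = c.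
Proof.
elim: c => // c IH; rewrite (_ : 2 * c.+1 + 1 = 2 * c + 1 + 2); last by lia.
by rewrite iotaD count_cat IH /=; lia.
Qed.

Section NormalSpread.
Variables (T : finType) (k l : nat) (tau : nat -> T).
Hypotheses (l_gt1 : 1 < l) (le_lk : l <= k.+1) (odd_kl : odd k != odd l).
Local Notation K := (k + l).
Local Notation n := (2 * k + l).
Local Notation D := (window tau 0 K).
Local Notation P := (odd_letters (window tau 0 n)).
Hypotheses (per : periodic n tau) (run : uniq D).
Hypotheses (tail : uniq (window tau K k)) (norm : normal_word k l tau).

Let split_n : window tau 0 n = D ++ window tau K k.
Proof. by rewrite -window_cat; congr window; lia. Qed.

(** The same localisation as [tail_letter_pos], now from the shape of the word. *)
Lemma normal_tail_pos i x : i < k -> x < K -> tau (K + i) = tau x ->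
  [/\ odd x, i < x & x < i + l].
Proof.
move=> hi hx e; have := norm hi.
have inj y : y < K -> tau x = tau y -> x = y.
  by move=> hy; apply: window_uniq_inj run _ _; lia.
case: ifP => h1; first by rewrite e => /inj h; rewrite (h ltac:(lia)); split; lia.
case: ifP => h2; first by rewrite e => /inj h; rewrite (h ltac:(lia)); split; lia.
by rewrite e mem_window.
Qed.

Lemma normal_in_tail x : x < K -> (tau x \in window tau K k) = odd x.
Proof.
move=> hx; apply/idP/idP => [/mem_windowP[j hj e] | ox].
  have hj' : j - K < k by lia.
  by have [|-> _ _] := normal_tail_pos hj' hx; first by rewrite subnKC ?e //; lia.
have [x_small | x_big] := leqP x (2 * l - 3).
  have hi : x./2 < k by lia.
  have := norm hi; rewrite ifT; last by lia.
  have -> : 2 * x./2 + 1 = x by lia.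
  by move=> <-; apply: mem_window; lia.
have hi : x - l.-1 < k by lia.
have := norm hi; rewrite ifF; last by lia.
rewrite ifT; last by lia.
have -> : x - l.-1 + l.-1 = x by lia.
by move=> <-; apply: mem_window; lia.
Qed.

Lemma normal_odd_run x : x < K -> (tau x \in P) = ~~ odd x.
Proof.
move=> hx; rewrite split_n odd_letters_cat !odd_letters_uniq //.
by rewrite mem_window // normal_in_tail.
Qed.

Lemma normal_odd_tail i : i < k ->
  (tau (K + i) \in P) = (l.-1 <= i) && ~~ odd (i - l.-1).
Proof.
move=> hi; rewrite split_n odd_letters_cat !odd_letters_uniq //.
rewrite (mem_window tau (i := K)); last by lia.
rewrite addbT; have := norm hi.
case: ifP => h1; first by rewrite leqNgt h1 => ->; rewrite mem_window //; lia.
rewrite leqNgt h1 /=; case: ifP => h2 /=; last by move=> ->.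
by move=> ->; rewrite mem_window //; lia.
Qed.

Lemma normal_sparse p : ~~ ((tau p \in P) && (tau p.+1 \in P)).
Proof.
have n_gt0 : 0 < n by lia.
have -> : tau p = tau (p %% n) by rewrite (periodic_mod p per).
have -> : tau p.+1 = tau (p %% n).+1.
  rewrite -(periodic_mod p.+1 per) -(periodic_mod (p %% n).+1 per).
  by rewrite -addn1 -[in RHS]addn1 modnDml.
have := ltn_pmod p n_gt0; move: (p %% n) => q lt_qn.
have [lt_qK | le_Kq] := ltnP q K.
  rewrite normal_odd_run //; have [lt_q1 | le_q1] := ltnP q.+1 K.
    by rewrite normal_odd_run //=; case: (odd q).
  have -> : q.+1 = K + 0 by lia.
  by rewrite normal_odd_tail //; lia.
have eq : q = K + (q - K) by lia.
have hq : q - K < k by lia.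
rewrite [in tau q]eq normal_odd_tail //.
have [lt_q1 | le_q1] := ltnP q.+1 n.
  by rewrite (_ : q.+1 = K + (q - K).+1) ?normal_odd_tail //; lia.
have -> : q.+1 = 0 + n by lia.
by rewrite per normal_odd_run //; lia.
Qed.

Lemma normal_card_odd : #|P| = k.+1.
Proof.
have /perm_odd_letters-> : perm_eq (window tau 0 n) (window tau K k ++ D).
  by rewrite split_n perm_catC.
have := card_odd_letters_cat (window tau K k) run.
rewrite (card_odd_letters_uniq tail) !size_window count_map.
rewrite (@eq_in_count _ _ odd) => [|x]; last first.
  by rewrite mem_iota /= => hx; rewrite odd_letters_uniq ?normal_in_tail.
have -> : K = 2 * K./2 + 1 by lia.
by rewrite count_odd_iota; lia.
Qed.

(** Letters are distinct within the run and within the tail. So either the window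
    or its complement in a period has distinct letters, or the window crosses just
    one border, from run to tail or from tail to the next run. *)
Lemma normal_spread : spread k n tau.
Proof.
have n_gt0 : 0 < n by lia.
have uniq_case i m : uniq (window tau i m) ->
    minn m k <= #|odd_letters (window tau i m)|.
  by move=> U; rewrite (card_odd_letters_uniq U) size_window geq_minl.
have compl_case i m : m <= n -> uniq (window tau (i + m) (n - m)) ->
    minn m k <= #|odd_letters (window tau i m)|.
  move=> le_mn U; have := card_odd_letters_compl per (leq_subr m n) U.
  rewrite subKn // -addnA subnKC // window_shift // normal_card_odd count_map.
  by have := @count_sparse (preim tau [in P]) (i + m) (n - m) normal_sparse; lia.
move=> i m le_mn.
have -> : window tau i m = window tau (i %% n) m.
  by rewrite {1}(divn_eq i n) addnC window_shift_mul.
have := ltn_pmod i n_gt0; move: (i %% n) => {}i lt_in.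
have cross_case (u v : seq T) c : uniq u -> uniq v -> count [in u] v <= c ->
    size u + size v <= 2 * c + #|odd_letters (u ++ v)|.
  move=> Uu Uv; have := card_odd_letters_cat u Uv.
  rewrite (card_odd_letters_uniq Uu) => <-.
  rewrite (@eq_count _ _ [in u]) => [|x]; first by lia.
  exact: odd_letters_uniq.
have [lt_iK | le_Ki] := ltnP i K.
  have [le_mK | lt_Km] := leqP (i + m) K.
    by apply: uniq_case; apply: (sub_window_uniq _ _ run); lia.
  have [le_m | lt_m] := leqP (i + m) n; last first.
    apply: compl_case => //; rewrite (_ : i + m = i + m - n + n); last by lia.
    by rewrite window_shift //; apply: (sub_window_uniq _ _ run); lia.
  have Uu : uniq (window tau K (i + m - K)) by apply: (sub_window_uniq _ _ tail); lia.
  have Uv : uniq (window tau i (K - i)) by apply: (sub_window_uniq _ _ run); lia.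
  have e : perm_eq (window tau i m) (window tau K (i + m - K) ++ window tau i (K - i)).
    rewrite perm_sym perm_catC (@window_split _ _ i (K - i) m); last by lia.
    have -> : i + (K - i) = K by rewrite subnKC // ltnW.
    by have -> : m - (K - i) = i + m - K by lia.
  (* A repeated letter sits at an odd position of the run, between the start of
     the window and the last position at distance more than k from its end. *)
  have /(cross_case _ _ _ Uu Uv) :
      count [in window tau K (i + m - K)] (window tau i (K - i))
      <= (l + (i + m - K) - 1 - i).+1./2.
    rewrite count_map; apply: (@count_odd_bound _ _ _ i) => x hx /mem_windowP[j hj ej].
    have hj' : j - K < k by clear -hj le_m lt_Km; lia.
    have hx' : x < K by clear -hx lt_iK; lia.
    have [|ox h1 h2] := normal_tail_pos hj' hx'.
      by rewrite subnKC ?ej //; clear -hj; lia.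
    by clear -ox h1 h2 hj hx le_m lt_Km lt_iK; lia.
  rewrite -(perm_odd_letters e) !size_window.
  by clear -le_m lt_Km lt_iK l_gt1; lia.
have [le_m | lt_m] := leqP (i + m) n.
  by apply: uniq_case; apply: (sub_window_uniq _ _ tail); lia.
have [le_m2 | lt_m2] := leqP (i + m) (n + K); last first.
  apply: compl_case => //; rewrite (_ : i + m = i + m - n + n); last by lia.
  by rewrite window_shift //; apply: (sub_window_uniq _ _ tail); lia.
have Uu : uniq (window tau i (n - i)) by apply: (sub_window_uniq _ _ tail); lia.
have Uv : uniq (window tau 0 (i + m - n)) by apply: (sub_window_uniq _ _ run); lia.
have e : window tau i m = window tau i (n - i) ++ window tau 0 (i + m - n).
  rewrite -(window_shift 0 _ per) (@window_split _ _ i (n - i) m); last by lia.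
  by congr (_ ++ window _ _ _); lia.
have /(cross_case _ _ _ Uu Uv) :
    count [in window tau i (n - i)] (window tau 0 (i + m - n))
    <= (i + m - n - (i - K).+1).+1./2.
  rewrite count_map.
  apply: (@count_odd_bound _ _ _ (i - K).+1) => x hx /mem_windowP[j hj ej].
  have hj' : j - K < k by clear -hj le_Ki lt_in; lia.
  have hx' : x < K by clear -hx le_m2 lt_in; lia.
  have [|ox h1 h2] := normal_tail_pos hj' hx'.
    by rewrite subnKC ?ej //; clear -hj le_Ki; lia.
  by clear -ox h1 h2 hj hx le_m2 lt_m lt_in le_Ki; lia.
rewrite -e !size_window.
by clear -le_m2 lt_m lt_in le_Ki l_gt1; lia.
Qed.
End NormalSpread.

(** * The normal word and its relabellings *)

(** The normal word over the letters 0, 1, and so on, with the run letters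
    numbered by their place and then the other letters by order of appearance. *)
Definition normal_index k l j : nat :=
  if j < k + l then j
  else let i := j - (k + l) in
       if i < l.-1 then 2 * i + 1
       else if odd (i - l.-1) then i + l.-1
       else k + l + (i - l.-1)./2.

Section NormalLetters.
Variables (k l d : nat).
Local Notation K := (k + l).
Local Notation n := (2 * k + l).

Lemma normal_index_lt j : 2 * d = 3 * k + l + 1 -> l <= k.+1 -> j < n ->
  normal_index k l j < d.
Proof.
move=> eq_d le_lk hj; rewrite /normal_index; case: ifP => h; first by lia.
by case: ifP => h1; [|case: ifP => h2]; lia.
Qed.

Lemma normal_letters : l <= k.+1 -> 2 * d = 3 * k + l + 1 ->
  exists tau : nat -> 'I_d,
  [/\ periodic n tau & forall j, j < n -> tau j = normal_index k l j :> nat].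
Proof.
move=> le_lk eq_d; have d_gt0 : 0 < d by lia.
exists (fun j => insubd (Ordinal d_gt0) (normal_index k l (j %% n))).
split=> [j | j hj]; first by rewrite modnDr.
by rewrite modn_small // val_insubd normal_index_lt.
Qed.

Variable tau : nat -> 'I_d.
Hypothesis tauE : forall j, j < n -> tau j = normal_index k l j :> nat.

Let tau_run j : j < K -> tau j = j :> nat.
Proof. by move=> hj; rewrite tauE /normal_index ?hj //; lia. Qed.

Let tau_tail i : i < k -> tau (K + i) =
  (if i < l.-1 then 2 * i + 1 else if odd (i - l.-1) then i + l.-1
   else K + (i - l.-1)./2) :> nat.
Proof.
move=> hi; rewrite tauE; last by lia.
by rewrite /normal_index ifF ?addKn //; lia.
Qed.

Lemma normal_letters_run : uniq (window tau 0 K).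
Proof.
apply/window_uniqP => a b _ ab hb /(congr1 val) /=.
by rewrite !tau_run; lia.
Qed.

Lemma normal_letters_tail : uniq (window tau K k).
Proof.
apply/window_uniqP => a b ha ab hb /(congr1 val) /=.
have ea : a = K + (a - K) by lia.
have eb : b = K + (b - K) by lia.
rewrite ea eb !tau_tail; try lia.
by do ![case: ifP => ?]; lia.
Qed.

Lemma normal_letters_normal : normal_word k l tau.
Proof.
move=> i hi; have := tau_tail hi.
case: ifP => h1; [|case: ifP => h2] => e.
- by apply: val_inj; rewrite /= e tau_run //; lia.
- by apply: val_inj; rewrite /= e tau_run //; lia.
apply/mem_windowP => -[j hj] /(congr1 val) /=.
by rewrite e tau_run; lia.
Qed.

Lemma relabel_normal (tau' : nat -> 'I_d) :
  1 < l -> 2 * d = 3 * k + l + 1 ->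
  uniq (window tau' 0 K) -> uniq (window tau' K k) -> normal_word k l tau' ->
  exists s : {perm 'I_d}, forall j, j < n -> tau' j = s (tau j).
Proof.
move=> l_gt1 eq_d run' tail' norm'.
(* The place where the letter numbered x occurs first. *)
pose pos x := if x < K then x else K + (l.-1 + 2 * (x - K)).
have new x : K <= x -> x < d ->
    [/\ l.-1 + 2 * (x - K) < k & tau' (pos x) \notin window tau' 0 K].
  move=> h1 h2; have hi : l.-1 + 2 * (x - K) < k by lia.
  split=> //; have := norm' _ hi; rewrite /pos !ifF //; lia.
have f_inj : injective (fun x : 'I_d => tau' (pos x)).
  move=> x y exy; apply: val_inj => /=; move: exy.
  have hx := ltn_ord x; have hy := ltn_ord y.
  have [xK | xK] := ltnP x K; have [yK | yK] := ltnP y K.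
  - rewrite /pos xK yK => e.
    by apply: (window_uniq_inj run' _ _ e); lia.
  - have [_] := new y yK hy; rewrite {2}/pos xK => /negP nin e.
    by case: nin; rewrite -e mem_window.
  - have [_] := new x xK hx; rewrite {3}/pos yK => /negP nin e.
    by case: nin; rewrite e mem_window.
  have [lx _] := new x xK hx; have [ly _] := new y yK hy.
  rewrite /pos !ifF; try lia.
  by move=> /(window_uniq_inj tail'); lia.
exists (perm f_inj) => j hj; rewrite permE.
have [lt_jK | le_Kj] := ltnP j K; first by rewrite tau_run // /pos lt_jK.
have ej : j = K + (j - K) by lia.
have hi : j - K < k by lia.
rewrite ej tau_tail //; have := norm' _ hi.
case: ifP => h1; first by rewrite /pos ifT; last by lia.
case: ifP => h2; first by rewrite /pos ifT; last by lia.
by move=> _; rewrite /pos ifF; [congr tau' |]; lia.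
Qed.
End NormalLetters.

(** * Codes and words *)

Section CyclicSequence.
Variables (A : eqType) (N : nat) (v : nat -> A).
Hypotheses (N_gt0 : 0 < N) (per : periodic N v) (Uv : uniq (window v 0 N)).

Lemma mem_cyclic j : v j \in window v 0 N.
Proof. by rewrite -(periodic_mod j per) mem_window //= ltn_mod. Qed.

Lemma window_uniq_rot i : uniq (window v i N).
Proof.
have lt_iN : i %% N < N by rewrite ltn_mod.
rewrite (divn_eq i N) addnC window_shift_mul //.
by rewrite -[i %% N]add0n -(rot_window 0 per (ltnW lt_iN)) rot_uniq.
Qed.

Lemma index_cyclic i j : j < N -> index (v (i + j)) (window v i N) = j.
Proof.
move=> lt_jN; rewrite -(nth_window v (v 0) i lt_jN).
by rewrite index_uniq ?size_window // window_uniq_rot.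
Qed.

Lemma next_cyclic j : next (window v 0 N) (v j) = v j.+1.
Proof.
have -> : v j.+1 = v (j %% N).+1.
  by rewrite {1}(divn_eq j N) addnC -addSn periodic_mul.
rewrite -(periodic_mod j per); have : j %% N < N by rewrite ltn_mod.
move: (j %% N) => {}j lt_jN; rewrite next_nth mem_cyclic.
have := index_cyclic 0 lt_jN; rewrite add0n => ->.
case: N per lt_jN => // N' per' lt_jN /=; rewrite -/(window v 1 N').
case: (ltngtP j N') lt_jN => [lt_j _ | | -> _]; [by rewrite nth_window | lia |].
by rewrite nth_default ?size_window // -(per' 0).
Qed.

Lemma size_arc_cyclic i m : m < N ->
  size (arc (window v 0 N) (v i) (v (i + m))) = m.
Proof.
move=> lt_mN; have lt_iN : i %% N < N by rewrite ltn_mod.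
have -> : v (i + m) = v (i %% N + m).
  by rewrite {1}(divn_eq i N) -addnA addnC periodic_mul.
rewrite -(periodic_mod i per); move: (i %% N) lt_iN => {}i lt_iN.
rewrite /arc; have := index_cyclic 0 lt_iN; rewrite add0n => ->.
rewrite (rot_window _ per (ltnW lt_iN)) index_cyclic //.
by rewrite size_take size_window lt_mN.
Qed.
End CyclicSequence.

Section Walks.
Variables (d : nat) (v : nat -> cube d) (tau : nat -> 'I_d).
Hypothesis step : forall j x, v j.+1 x = v j x (+) (x == tau j).

Lemma walk_parity i m x :
  v (i + m) x = v i x (+) (x \in odd_letters (window tau i m)).
Proof.
elim: m => [|m IH]; first by rewrite addn0 inE addbF.
rewrite addnS step IH -addn1 window_cat odd_letters_cat addbA.
by rewrite [x \in odd_letters (window _ _ 1)]odd_letters_uniq // mem_seq1.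
Qed.

Lemma walk_hamming i m :
  hamming (v i) (v (i + m)) = #|odd_letters (window tau i m)|.
Proof.
apply: eq_card => x; rewrite inE walk_parity.
by case: (v i x); case: (x \in _).
Qed.

Lemma walk_transitions N : 0 < N -> periodic N v -> uniq (window v 0 N) ->
  transitions (window v 0 N) = window tau 0 N.
Proof.
move=> N_gt0 per Uv; rewrite /transitions.
have pickE j : [pick i | v j i != next (window v 0 N) (v j) i] = Some (tau j).
  rewrite next_cyclic //; case: pickP => [i | /(_ (tau j))].
    by rewrite step; case: (i =P tau j) => [-> // | _]; rewrite addbF eqxx.
  by rewrite step eqxx; case: (v j _).
by rewrite {2 3}/window; elim: (iota 0 N) => //= j s IH; rewrite pickE /= IH.
Qed.
End Walks.

Lemma hammingC d (x y : cube d) : hamming x y = hamming y x.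
Proof. by apply: eq_card => i; rewrite !inE eq_sym. Qed.

Lemma cycle_distC d (C : seq (cube d)) x y : cycle_dist C x y = cycle_dist C y x.
Proof. exact: minnC. Qed.

(** The distance along the cycle is m only for m at most half the length, which is
    why longer windows are excluded. *)
Lemma code_walk d k (C : seq (cube d)) : circuit_code k C ->
  exists (tau : nat -> 'I_d),
    [/\ periodic (size C) tau, transitions C = window tau 0 (size C)
      & forall i m, 2 * m <= size C ->
          minn m k <= #|odd_letters (window tau i m)|].
Proof.
case/and4P => N_gt2 /andP[cyc UC] _ dist; set N := size C.
have N_gt0 : 0 < N by lia.
pose v j := nth (cube0 d) C (j %% N).
have per_v : periodic N v by move=> j; rewrite /v modnDr.
have eC : window v 0 N = C.
  apply: (@eq_from_nth _ (cube0 d)) => [|j]; rewrite size_window // => lt_jN.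
  by rewrite nth_window // /v modn_small.
have Uv : uniq (window v 0 N) by rewrite eC.
have adj j : #|[set x | v j x != v j.+1 x]| = 1.
  apply/eqP; rewrite -/(hamming (v j) (v j.+1)) -(next_cyclic N_gt0 per_v Uv).
  by rewrite eC; apply: (next_cycle cyc); rewrite -eC mem_cyclic.
have [t0 _] : exists t, [set x | v 0 x != v 1 x] = [set t] by apply/cards1P/eqP/adj.
pose tau j := odflt t0 [pick x | v j x != v j.+1 x].
have step j x : v j.+1 x = v j x (+) (x == tau j).
  have /eqP/cards1P[t /setP et] := adj j.
  have et' y : (v j y != v j.+1 y) = (y == t) by have := et y; rewrite !inE.
  have -> : tau j = t.
    rewrite /tau; case: pickP => [y | /(_ t)]; rewrite et' ?eqxx //.
    by move/eqP.
  by rewrite -et'; case: (v j x); case: (v j.+1 x).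
exists tau; split; first by move=> j; rewrite /tau -addSn !per_v.
  by rewrite -eC (walk_transitions step).
move=> i [|m] le_mN; first by rewrite min0n.
rewrite -(walk_hamming step); move/allrelP: dist => /(_ (v i) (v (i + m.+1))).
rewrite -!eC !mem_cyclic // => /(_ isT isT); apply: leq_trans.
rewrite /cycle_dist size_arc_cyclic //; last by lia.
have -> : v i = v (i + m.+1 + (N - m.+1)).
  by rewrite -[LHS]per_v; congr v; lia.
rewrite size_arc_cyclic //; last by lia.
by lia.
Qed.

(** The walk from the origin closes up after 2n steps because each letter is then
    used an even number of times. *)
Lemma code_of_word d k n (tau : nat -> 'I_d) : 0 < k -> 1 < n ->
  periodic n tau -> spread k n tau ->
  exists C : seq (cube d), [/\ circuit_code k C, size C = n + n
    & transitions C = window tau 0 (n + n)].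
Proof.
move=> k_gt0 n_gt1 per sp; set N := n + n.
pose v j : cube d := [ffun x => x \in odd_letters (window tau 0 j)].
have step j x : v j.+1 x = v j x (+) (x == tau j).
  rewrite !ffunE -addn1 window_cat odd_letters_cat.
  by rewrite [x \in odd_letters (window _ _ 1)]odd_letters_uniq // mem_seq1.
have per_v : periodic N v.
  move=> j; apply/ffunP => x; rewrite (walk_parity step) /N window_cat.
  by rewrite odd_letters_cat window_shift // addbb addbF.
have ham_ge i m : m <= n -> minn m k <= hamming (v i) (v (i + m)).
  by move=> le_mn; rewrite (walk_hamming step); apply: sp.
have ham0 x : hamming x x = 0 :> nat.
  by apply/eqP; rewrite cards_eq0; apply/eqP/setP => i; rewrite !inE eqxx.
have Uv : uniq (window v 0 N).
  apply/window_uniqP => a b _ ab bN eab.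
  have [le_n | lt_n] := leqP (b - a) n.
    have := ham_ge a (b - a) le_n; rewrite subnKC ?(ltnW ab) // eab ham0; lia.
  have le_n' : N - (b - a) <= n by lia.
  have := ham_ge b _ le_n'; rewrite (_ : b + _ = a + N); last by lia.
  by rewrite per_v eab ham0; lia.
have N_gt0 : 0 < N by lia.
exists (window v 0 N); split; rewrite ?size_window //; last first.
  exact: (walk_transitions step N_gt0 per_v Uv).
apply/and4P; split; first by rewrite size_window; lia.
- apply/andP; split=> //; apply: cycle_from_next => // _ /mem_windowP[j _ ->].
  rewrite next_cyclic // /cube_adj -addn1 (walk_hamming step).
  by rewrite card_odd_letters_uniq.
- case: N N_gt0 per_v Uv => // N' _ _ _ /=; apply/eqP; congr Some.
  by apply/ffunP => x; rewrite !ffunE inE.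
have close a m : m < N -> minn (cycle_dist (window v 0 N) (v a) (v (a + m))) k
                          <= hamming (v a) (v (a + m)).
  move=> lt_mN; have [le_mn | lt_nm] := leqP m n.
    apply: leq_trans (ham_ge a m le_mn).
    by rewrite /cycle_dist size_arc_cyclic //; lia.
  have le_n' : N - m <= n by lia.
  rewrite hammingC -(per_v a) (_ : a + N = a + m + (N - m)); last by lia.
  apply: leq_trans (ham_ge (a + m) _ le_n'); rewrite cycle_distC /cycle_dist.
  by rewrite (size_arc_cyclic N_gt0 per_v Uv (a + m)); lia.
apply/allrelP => _ _ /mem_windowP[a ha ->] /mem_windowP[b hb ->].
have [le_ab | lt_ba] := leqP a b.
  by have := close a (b - a); rewrite subnKC //; apply; lia.
have := close b (a - b); rewrite (subnKC (ltnW lt_ba)) cycle_distC hammingC.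
by apply; lia.
Qed.

Lemma max_bit_runP d (C : seq (cube d)) r : 0 < r ->
  reflect (exists i m, [/\ i < size C, m <= size C, r <= m
                         & uniq (segment (transitions C) i m)])
          (r <= max_bit_run C).
Proof.
move=> r_gt0; apply: (iffP idP) => [le_r | [i [m [hi hm le_rm U]]]].
  have /existsP[i /existsP[m /andP[U le_rm]]] : [exists i : 'I_(size C),
      exists m : 'I_(size C).+1, uniq (segment (transitions C) i m) && (r <= m)].
    apply: contraLR le_r => /existsPn none; rewrite -ltnNge -(prednK r_gt0) ltnS.
    apply/bigmax_leqP => i _; apply/bigmax_leqP => m U.
    have := none i; rewrite negb_exists => /forallP/(_ m).
    by rewrite U /= -ltnNge; lia.
  by exists i, m; split=> //; rewrite -ltnS.
apply: (leq_trans le_rm); rewrite /max_bit_run.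
apply: (bigmax_sup (Ordinal hi)) => //.
have hm' : m < (size C).+1 by [].
exact: (bigmax_sup (Ordinal hm')).
Qed.

Lemma segment_window (A : Type) (tau : nat -> A) N i m : periodic N tau ->
  i <= N -> m <= N -> segment (window tau 0 N) i m = window tau i m.
Proof. by move=> per hi hm; rewrite /segment rot_window // take_window. Qed.

Lemma symmetric_word d k (C : seq (cube d)) :
  circuit_code k C -> symmetric_code C ->
  exists n (tau : nat -> 'I_d),
    [/\ size C = n + n, 1 < n, periodic n tau, spread k n tau
      & transitions C = window tau 0 (n + n)].
Proof.
move=> cC; have [tau [perN eT dist]] := code_walk cC.
have N_gt2 : 2 < size C by case/and4P: cC.
rewrite /symmetric_code eT; set N := size C in perN eT dist N_gt2 *.
rewrite take_window ?drop_window; last by lia.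
move/eqP => eq_half; have := congr1 size eq_half; rewrite !size_window => hN.
set n := N./2 in eq_half hN.
have eN : N = n + n by lia.
have n_gt0 : 0 < n by lia.
have half j : j < n -> tau (j + n) = tau j.
  move=> hj; have := nth_window tau (tau 0) 0 hj.
  by rewrite eq_half -hN nth_window // addnC => ->.
have per : periodic n tau.
  move=> j; have -> : tau (j + n) = tau (j %% N + n).
    by rewrite {1}(divn_eq j N) -addnA addnC periodic_mul.
  rewrite -(periodic_mod j perN).
  have : j %% N < N by rewrite ltn_mod; lia.
  move: (j %% N) => {}j hj; have [lt_jn | le_nj] := ltnP j n; first exact: half.
  rewrite -(subnK le_nj) [in RHS]half; last by lia.
  by rewrite -addnA -eN perN.
exists n, tau; split; rewrite -?eN //; first by lia.
by move=> i m hm; apply: dist; lia.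
Qed.

Lemma long_run_word d k r (C : seq (cube d)) : 0 < r ->
  code_family k r C -> symmetric_code C ->
  exists n i (tau : nat -> 'I_d),
    [/\ size C = n + n, i <= n + n,
        rot i (transitions C) = window tau 0 (n + n) & r <= n]
    /\ [/\ periodic n tau, spread k n tau & uniq (window tau 0 r)].
Proof.
move=> r_gt0 /andP[cC /(max_bit_runP _ r_gt0)[i [m [hi hm le_rm U]]]] symC.
have [n [tau [eN n_gt1 per sp eT]]] := symmetric_word cC symC.
have perN : periodic (n + n) tau by move=> j; rewrite addnA !per.
rewrite eN in hi hm.
have Ur : uniq (window tau (i + 0) r).
  rewrite eT segment_window // in U; last exact: ltnW.
  by apply: sub_window_uniq U; lia.
exists n, i, (fun j => tau (i + j)); split; split=> //.
- exact: ltnW.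
- by rewrite window_add addn0 eT rot_window ?add0n // ltnW.
- rewrite leqNgt; apply/negP => lt_nr.
  by move/window_uniqP: Ur => /(_ i (i + n)); rewrite per; apply=> //; lia.
- by move=> j; rewrite addnA per.
- by move=> j q hq; rewrite window_add; apply: sp.
by rewrite window_add.
Qed.

Lemma code_iso_rot d (C C' : seq (cube d)) q (s : {perm 'I_d}) :
  rot q (transitions C') = [seq s t | t <- transitions C] -> code_iso C C'.
Proof.
move=> e; exists (size (transitions C) - q), s.
by rewrite map_rot -e -{1}(size_map s) -e -/(rotr q _) rotK.
Qed.

Section Symmetric.
Variables (k l d : nat).
Hypotheses (l_gt1 : 1 < l) (le_l_k : 2 * l - 2 <= k) (odd_kl : odd k != odd l).
Hypothesis eq_d : 2 * d = 3 * k + l + 1.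
Local Notation n := (2 * k + l).

Let cardI : 2 * #|'I_d| = 3 * k + l + 1. Proof. by rewrite card_ord. Qed.
Let le_lk : l <= k.+1. Proof. by lia. Qed.
Let run_gt0 : 0 < k + l. Proof. by lia. Qed.

Lemma symmetric_size_le (C : seq (cube d)) :
  code_family k (k + l) C -> symmetric_code C -> size C <= 4 * k + 2 * l.
Proof.
move=> famC symC.
have [m [i [tau [[-> _ _ le_m] [per sp run]]]]] := long_run_word run_gt0 famC symC.
by have := period_le_of_run l_gt1 le_l_k odd_kl cardI per sp le_m run; lia.
Qed.

Lemma normal_code_exists : exists (C : seq (cube d)) (tau : nat -> 'I_d),
  [/\ code_family k (k + l) C, symmetric_code C, size C = 4 * k + 2 * l
    & transitions C = window tau 0 (n + n)]
  /\ (periodic n tau /\ forall j, j < n -> tau j = normal_index k l j :> nat).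
Proof.
have [tau [per tauE]] := normal_letters le_lk eq_d.
have run := normal_letters_run tauE.
have tail := normal_letters_tail tauE.
have norm := normal_letters_normal tauE.
have sp := normal_spread l_gt1 le_lk odd_kl per run tail norm.
have k_gt0 : 0 < k by lia.
have n_gt1 : 1 < n by lia.
have [C [cC sC eT]] := code_of_word k_gt0 n_gt1 per sp.
have perN : periodic (n + n) tau by move=> j; rewrite addnA !per.
exists C, tau; split; last by []; split=> //; last by lia.
  rewrite /code_family cC; apply/max_bit_runP => //.
  exists 0, (k + l); rewrite sC eT segment_window //; last by lia.
  by split=> //; lia.
rewrite /symmetric_code sC eT (_ : (n + n)./2 = n); last by lia.
by rewrite take_window ?drop_window ?addnK ?window_shift //; lia.
Qed.

Lemma max_sym_lengthE : max_sym_length d k (k + l) = 4 * k + 2 * l.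
Proof.
apply/eqP; rewrite eqn_leq; apply/andP; split.
  apply/bigmax_leqP => N /existsP[C /andP[famC symC]].
  by rewrite -(size_tuple C); apply: symmetric_size_le.
have [C [_ [[famC symC sC _] _]]] := normal_code_exists.
have lt_N : size C < #|{: cube d}|.+1.
  have /andP[/and4P[_ /andP[_ UC] _ _] _] := famC.
  by rewrite ltnS -(card_uniqP UC) max_card.
rewrite -sC; apply: (bigmax_sup (Ordinal lt_N)) => //.
by apply/existsP; exists (in_tuple C); rewrite famC.
Qed.

Lemma normal_rotation (C : seq (cube d)) : l = 2 \/ l = 3 ->
  code_family k (k + l) C -> symmetric_code C -> size C = 4 * k + 2 * l ->
  exists q (tau : nat -> 'I_d),
    [/\ rot q (transitions C) = window tau 0 (n + n), periodic n tau,
        spread k n tau, uniq (window tau 0 (k + l)) & normal_word k l tau].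
Proof.
move=> l23 famC symC sC.
have [m [i [tau [[eN hi eT _] [per sp run]]]]] := long_run_word run_gt0 famC symC.
have em : m = n by lia.
subst m; case: l23 => [l2 | l3].
  by exists i, tau; split=> //; apply: normal_word_l2.
have [p [le_pn Up e3]] := normal_shift_l3 l_gt1 le_l_k odd_kl cardI per sp run l3.
have perN : periodic (n + n) tau by move=> j; rewrite addnA !per.
have sizeT : size (transitions C) = n + n by rewrite -(size_rot i) eT size_window.
exists (if p + i <= n + n then p + i else p + i - (n + n)), (fun j => tau (p + j)).
have per' : periodic n (fun j => tau (p + j)) by move=> j; rewrite addnA per.
have sp' : spread k n (fun j => tau (p + j)).
  by move=> j q hq; rewrite window_add; apply: sp.
have run' : uniq (window (fun j => tau (p + j)) 0 (k + l)).
  by rewrite window_add addn0.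
split=> //; last by apply: normal_word_l3.
rewrite -{1 2}sizeT -rot_add_mod ?sizeT //; last by lia.
by rewrite eT window_add addn0 rot_window //; lia.
Qed.

Lemma symmetric_code_unique (C C' : seq (cube d)) (tau : nat -> 'I_d) :
  l = 2 \/ l = 3 -> transitions C = window tau 0 (n + n) -> periodic n tau ->
  (forall j, j < n -> tau j = normal_index k l j :> nat) ->
  code_family k (k + l) C' -> symmetric_code C' -> size C' = 4 * k + 2 * l ->
  code_iso C C'.
Proof.
move=> l23 eT per tauE famC symC sC.
have [q [tau' [eT' per' sp' run' norm']]] := normal_rotation l23 famC symC sC.
have lt_kn : k < n by lia.
have tail' : uniq (window tau' (k + l) k) by apply: spread_uniq sp' lt_kn _.
have [s es] := relabel_normal tauE l_gt1 eq_d run' tail' norm'.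
apply: (@code_iso_rot _ _ _ q s); rewrite eT eT' /window -map_comp.
apply: eq_map => j /=; rewrite -(periodic_mod j per) -(periodic_mod j per').
by apply: es; rewrite ltn_mod; lia.
Qed.
End Symmetric.

Theorem theorem1p3 (k l d : nat) (hk : 2 <= k) (hl : 2 <= l)
    (hpar : odd k != odd l)
    (hodd : odd k -> 2 * l + 1 <= k)
    (heven : ~~ odd k -> 2 * l - 2 <= k)
    (hd : d = (3 * k + l + 1)./2) :
  max_sym_length d k (k + l) = 4 * k + 2 * l
  /\
  (l = 2 \/ l = 3 ->
   exists C : seq (cube d),
     [/\ code_family k (k + l) C, symmetric_code C
       & size C = max_sym_length d k (k + l)]
     /\
     forall C' : seq (cube d),
       [/\ code_family k (k + l) C', symmetric_code C'
         & size C' = max_sym_length d k (k + l)] ->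
       code_iso C C').
Proof.
have eq_d : 2 * d = 3 * k + l + 1 by lia.
have le_l_k : 2 * l - 2 <= k.
  by have [/hodd | /heven //] := boolP (odd k); lia.
rewrite (max_sym_lengthE hl le_l_k hpar eq_d); split=> // l23.
have [C [tau [[famC symC sC eT] [per tauE]]]] :=
  normal_code_exists hl le_l_k hpar eq_d.
exists C; split=> // C' [famC' symC' sC'].
exact: (symmetric_code_unique hl le_l_k hpar eq_d l23 eT per tauE).
Qed.
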